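(* Let $G$ be a finite simple graph without isolated vertices and let $a \in \mathbb{R}\setminus\{0,1\}$. Then: (i) if $a>1$, then $\chi_{-a}(G) < ISD_a(G) \le 2^{a-1}\chi_{-a}(G)$; (ii) if $0<a<1$, then $2^{a-1}\chi_{-a}(G) \le ISD_a(G) < \chi_{-a}(G)$; (iii) if $a<0$, then $ISD_a(G) \le 2^{a-1}\chi_{-a}(G)$. The equality in the upper bound of (i), in the lower bound of (ii), or in the upper bound of (iii) is attained if and only if each connected component of $G$ is regular.
   Context: Graphs are undirected, finite, nonempty, simple (no loops, no multiple edges), without isolated vertices, and not necessarily connected. $d_u$ denotes the degree of the vertex $u$, and $uv$ denotes the (unordered) edge joining $u$ and $v$; sums over $uv\in E(G)$ run once over each edge. For $a\in\mathbb{R}$ the variable inverse sum deg index is $$ISD_a(G)=\sum_{uv\in E(G)}\frac{1}{d_u^a+d_v^a}.$$ For $b\in\mathbb{R}$ the general sum-connectivity index is $$\chi_{b}(G)=\sum_{uv\in E(G)}(d_u+d_v)^b.$$ A graph is regular if all its vertices have the same degree; different components may be regular of different degrees. *)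

(* Defs.v *)
From HB Require Import structures.
From mathcomp Require Import all_boot all_order all_algebra.
From mathcomp Require Import reals exp.

Set Implicit Arguments.
Unset Strict Implicit.
Unset Printing Implicit Defensive.

Import Order.TTheory GRing.Theory Num.Theory.

Local Open Scope ring_scope.

Record sgraph := SGraph {
  vertex :> finType;
  adj : rel vertex;
  adj_sym : symmetric adj;
  adj_irrefl : irreflexive adj }.

Definition deg (G : sgraph) (u : G) : nat := #|[set v : G | adj u v]|.

Definition no_isolated (G : sgraph) : Prop := forall u : G, exists v : G, adj u v.

(* The edge uv is encoded as the two-element set {u, v}, so that a sum over
   [edges G] visits each undirected edge once. *)
Definition edges (G : sgraph) : {set {set G}} :=
  [set [set u; v] | u in [set: G], v in [set: G] & adj u v].

Definition regular (G : sgraph) : Prop := forall u v : G, deg u = deg v.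

Section Induced.
Variables (G : sgraph) (C : {set G}).

Definition induced_adj : rel {x : G | x \in C} :=
  [rel x y | adj (val x) (val y)].

Lemma induced_adj_sym : symmetric induced_adj.
Proof. by move=> x y; rewrite /induced_adj /= adj_sym. Qed.

Lemma induced_adj_irrefl : irreflexive induced_adj.
Proof. by move=> x; rewrite /induced_adj /= adj_irrefl. Qed.

Definition induced : sgraph := SGraph induced_adj_sym induced_adj_irrefl.

End Induced.

Definition components (G : sgraph) : {set {set G}} :=
  equivalence_partition (connect (@adj G)) [set: G].

(* For an edge f = {u, v}, a sum over the w in f is the sum of its two
   endpoint values; see [sum_edge]. *)
Definition ISD (R : realType) (a : R) (G : sgraph) : R :=
  \sum_(f in edges G) 1 / (\sum_(w in f) (deg w)%:R `^ a).

Definition chi (R : realType) (b : R) (G : sgraph) : R :=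
  \sum_(f in edges G) (\sum_(w in f) (deg w)%:R) `^ b.

Lemma sum_edge (V : nmodType) (G : sgraph) (F : G -> V) (u v : G) :
  adj u v -> \sum_(w in [set u; v]) F w = F u + F v.
Proof.
move=> uv; have neq_uv : u != v.
  by apply/eqP=> eq_uv; move: uv; rewrite eq_uv adj_irrefl.
by rewrite big_setU1 ?inE //= big_set1.
Qed.

(* Main.v *)
Require Import Defs.
From HB Require Import structures.
From mathcomp Require Import all_boot all_order all_algebra.
From mathcomp Require Import reals exp.
From mathcomp Require Import sequences.
From mathcomp Require Import ring lra.

(** All the inequalities hold edge by edge.  Write [x] and [y] for the degrees
    of the endpoints of an edge; both are positive since no vertex is isolated.

    The strict inequalities say that [x `^ a + y `^ a] is below
    [(x + y) `^ a] when [1 < a] and above it when [0 < a < 1]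
    ([powR_superadditive], [powR_subadditive]); inverting both sides compares
    the two summands.  They survive summation because the graph has an edge.

    For the inequalities with the constant [2 `^ (a - 1)], note that
    [2 `^ (a - 1) * (x + y) `^ (- a)] is the inverse of
    [2 * ((x + y) / 2) `^ a] ([chi_term_mean]).  The summands are thus compared
    by midpoint convexity of the power with exponent [a], which is strictly
    convex on the positive reals when [a < 0] or [1 < a], and strictly concave
    when [0 < a < 1] ([powR_mean_le], [powR_mean_ge]).  Strictness means that
    an edge contributes equality exactly when [x = y].

    Hence the sums agree exactly when adjacent vertices always have equal
    degrees ([leif_sum_edges]).  By connectedness this says that the degree is
    constant on each component, and a vertex has the same degree in its
    component as in the whole graph ([regular_componentsP]). *)

Set Implicit Arguments.
Unset Strict Implicit.
Unset Printing Implicit Defensive.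

Import Order.TTheory GRing.Theory Num.Theory.

Local Open Scope ring_scope.

(** * Convexity of real powers *)

(** The tangent line at the barycentre [m] of [x] and [y] lies strictly below
    the graph of the exponential at both points, and the weighted mean of its
    two values there is exactly [expR m]. *)
Lemma expR_strict_convex (R : realType) (t x y : R) :
  0 < t < 1 -> x != y ->
  expR (t * x + (1 - t) * y) < t * expR x + (1 - t) * expR y.
Proof.
move=> /andP[t0 t1] neq_xy; set m := t * x + (1 - t) * y.
have neq0 : x - y != 0 by rewrite subr_eq0.
have xm : x - m != 0.
  have -> : x - m = (1 - t) * (x - y) by rewrite /m; lra.
  by rewrite mulf_neq0// subr_eq0 gt_eqF.
have ym : y - m != 0.
  have -> : y - m = - t * (x - y) by rewrite /m; lra.
  by rewrite mulf_neq0// oppr_eq0 gt_eqF.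
have -> : t * expR x + (1 - t) * expR y =
    expR m * (t * expR (x - m) + (1 - t) * expR (y - m)).
  rewrite mulrDr !(mulrCA (expR m)) -!expRD.
  by rewrite (addrC m) subrK (addrC m) subrK.
rewrite ltr_pMr ?expR_gt0//.
have := expR_gt1Dx xm; have := expR_gt1Dx ym.
move: (expR _) (expR (x - m)) => ey ex hy hx.
have : 0 < t * (ex - (1 + (x - m))) by rewrite mulr_gt0 // subr_gt0.
have : 0 < (1 - t) * (ey - (1 + (y - m))) by rewrite mulr_gt0 // subr_gt0.
rewrite /m; nra.
Qed.

Lemma powR_expR_ln (R : realType) (x a : R) : 0 < x -> x `^ a = expR (a * ln x).
Proof. by move=> x0; rewrite /powR gt_eqF. Qed.

(** Strict convexity of the exponential between [0] and [ln t], with weight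
    [a] on [ln t]. *)
Lemma bernoulli_powR_lt (R : realType) (a t : R) :
  0 < a < 1 -> 0 < t -> t != 1 -> t `^ a < 1 + a * (t - 1).
Proof.
move=> a01 t0 t1; have neq : ln t != 0 by rewrite ln_eq0.
have := expR_strict_convex a01 neq.
by rewrite mulr0 addr0 expR0 lnK// -powR_expR_ln//; lra.
Qed.

(** Strict convexity of the exponential bounds its value at the middle one of
    the three numbers [0], [ln t] and [a * ln t] by its values at the other two.
    The middle one is [ln t] when [1 < a], and [0] when [a < 0]; solving the
    bound for the value at [a * ln t] gives the Bernoulli inequality. *)
Lemma bernoulli_powR_gt (R : realType) (a t : R) :
  (a < 0) || (1 < a) -> 0 < t -> t != 1 -> 1 + a * (t - 1) < t `^ a.
Proof.
move=> ha t0 t1; have X0 : ln t != 0 by rewrite ln_eq0.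
rewrite powR_expR_ln//; case/orP: ha => [a0|a1].
- have a1 : 0 < 1 - a by lra.
  (* The combination of [a * ln t] and [ln t] with weight [(1 - a)^-1] is [0];
     the convexity bound is then multiplied by [1 - a]. *)
  have w01 : 0 < (1 - a)^-1 < 1 by rewrite invr_gt0 a1 invf_lt1//; lra.
  have neq : a * ln t != ln t.
    rewrite -subr_eq0 (_ : _ - _ = (a - 1) * ln t); last by lra.
    by rewrite mulf_neq0// subr_eq0 lt_eqF//; lra.
  have := expR_strict_convex w01 neq.
  have -> : (1 - a)^-1 * (a * ln t) + (1 - (1 - a)^-1) * ln t = 0.
    by field; rewrite gt_eqF.
  rewrite expR0 lnK// -(ltr_pM2l a1) mulrDr mulVKf ?gt_eqF//.
  have -> : (1 - a) * ((1 - (1 - a)^-1) * t) = - a * t.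
    by field; rewrite gt_eqF.
  lra.
- have a0 : 0 < a by lra.
  (* The combination of [a * ln t] and [0] with weight [a^-1] is [ln t]; the
     convexity bound is then multiplied by [a]. *)
  have w01 : 0 < a^-1 < 1 by rewrite invr_gt0 a0 invf_lt1.
  have neq : a * ln t != 0 by rewrite mulf_neq0// gt_eqF.
  have := expR_strict_convex w01 neq.
  rewrite mulr0 addr0 mulKf ?gt_eqF// expR0 lnK// mulr1 -(ltr_pM2l a0).
  by rewrite mulrDr mulVKf ?gt_eqF// mulrBr divff ?gt_eqF//; lra.
Qed.

(** Dividing by the midpoint of [x] and [y] puts the two points symmetrically
    around [1], so that the linear terms cancel when the Bernoulli bounds at
    [1 + e] and [1 - e] are added. *)
Lemma midpoint_rescale (R : realType) (x y : R) (m := (x + y) / 2) :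
  0 < x -> 0 < y -> x != y ->
  exists e : R, [/\ (0 < 1 + e) && (1 + e != 1), (0 < 1 - e) && (1 - e != 1),
    (forall a, x `^ a = m `^ a * (1 + e) `^ a) &
    (forall a, y `^ a = m `^ a * (1 - e) `^ a)].
Proof.
move=> x0 y0 neq_xy; have xy0 : 0 < x + y by rewrite addr_gt0.
have m0 : 0 < m by rewrite divr_gt0.
exists ((x - y) / (x + y)).
have xE : x = m * (1 + (x - y) / (x + y)) by rewrite /m; field; exact: lt0r_neq0.
have yE : y = m * (1 - (x - y) / (x + y)) by rewrite /m; field; exact: lt0r_neq0.
have e0 : (x - y) / (x + y) != 0.
  by rewrite mulf_neq0 ?invr_eq0 ?subr_eq0 ?lt0r_neq0.
move: e0 xE yE; set e := (x - y) / (x + y) => e0 xE yE.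
have s0 : 0 < 1 + e by rewrite -(pmulr_rgt0 _ m0) -xE.
have t0 : 0 < 1 - e by rewrite -(pmulr_rgt0 _ m0) -yE.
split=> [||a|a]; try by rewrite [in LHS](xE, yE) powRM// ltW.
- by rewrite s0 -subr_eq0 addrAC subrr add0r.
- by rewrite t0 -subr_eq0 addrAC subrr add0r oppr_eq0.
Qed.

Lemma powR_mean_le (R : realType) (a x y : R) :
  (a < 0) || (1 < a) -> 0 < x -> 0 < y ->
  2 * ((x + y) / 2) `^ a <= x `^ a + y `^ a ?= iff (x == y).
Proof.
move=> ha x0 y0; have [->|neq_xy] := eqVneq x y.
  have -> : (y + y) / 2 = y by lra.
  by rewrite mulr_natl mulr2n; exact/leif_refl.
apply/leifP; have [e [/andP[s0 s1] /andP[t0 t1] -> ->]] := midpoint_rescale x0 y0 neq_xy.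
rewrite -mulrDr mulrC ltr_pM2l ?powR_gt0 ?divr_gt0 ?addr_gt0//.
have := bernoulli_powR_gt ha s0 s1; have := bernoulli_powR_gt ha t0 t1; lra.
Qed.

Lemma powR_mean_ge (R : realType) (a x y : R) :
  0 < a < 1 -> 0 < x -> 0 < y ->
  x `^ a + y `^ a <= 2 * ((x + y) / 2) `^ a ?= iff (x == y).
Proof.
move=> ha x0 y0; have [->|neq_xy] := eqVneq x y.
  have -> : (y + y) / 2 = y by lra.
  by rewrite mulr_natl mulr2n; exact/leif_refl.
apply/leifP; have [e [/andP[s0 s1] /andP[t0 t1] -> ->]] := midpoint_rescale x0 y0 neq_xy.
rewrite -mulrDr [ltRHS]mulrC ltr_pM2l ?powR_gt0 ?divr_gt0 ?addr_gt0//.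
have := bernoulli_powR_lt ha s0 s1; have := bernoulli_powR_lt ha t0 t1; lra.
Qed.

(** The fractions [x / (x + y)] and [y / (x + y)] lie in [(0, 1)] and add up to
    [1], and on [(0, 1)] a power with exponent above [1] is below its base. *)
Lemma powR_superadditive (R : realType) (a x y : R) :
  1 < a -> 0 < x -> 0 < y -> x `^ a + y `^ a < (x + y) `^ a.
Proof.
move=> a1 x0 y0; have xy0 : 0 < x + y by rewrite addr_gt0.
have frac z : 0 < z -> z < x + y -> z `^ a < z / (x + y) * (x + y) `^ a.
  move=> z0 zlt; have p0 : 0 < z / (x + y) by rewrite divr_gt0.
  have p1 : z / (x + y) < 1 by rewrite ltr_pdivrMr// mul1r.
  rewrite -[in ltLHS](divfK (lt0r_neq0 xy0) z) powRM ?ltW// ltr_pM2r ?powR_gt0//.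
  rewrite powR_expR_ln// -[ltRHS]lnK// ltr_expR gtr_nMl// ln_lt0//.
  by rewrite p0.
have hx := frac x x0 ltac:(lra); have hy := frac y y0 ltac:(lra).
by rewrite (lt_le_trans (ltrD hx hy))// -mulrDl -mulrDl divff ?lt0r_neq0// mul1r.
Qed.

(** As for [powR_superadditive]: on [(0, 1)] a power with positive exponent
    below [1] is above its base. *)
Lemma powR_subadditive (R : realType) (a x y : R) :
  0 < a < 1 -> 0 < x -> 0 < y -> (x + y) `^ a < x `^ a + y `^ a.
Proof.
move=> /andP[a0 a1] x0 y0; have xy0 : 0 < x + y by rewrite addr_gt0.
have frac z : 0 < z -> z < x + y -> z / (x + y) * (x + y) `^ a < z `^ a.
  move=> z0 zlt; have p0 : 0 < z / (x + y) by rewrite divr_gt0.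
  have p1 : z / (x + y) < 1 by rewrite ltr_pdivrMr// mul1r.
  rewrite -[in ltRHS](divfK (lt0r_neq0 xy0) z) powRM ?ltW// ltr_pM2r ?powR_gt0//.
  rewrite [ltRHS]powR_expR_ln// -[ltLHS]lnK// ltr_expR ltr_nMl// ln_lt0//.
  by rewrite p0.
have hx := frac x x0 ltac:(lra); have hy := frac y y0 ltac:(lra).
by rewrite (le_lt_trans _ (ltrD hx hy))// -mulrDl -mulrDl divff ?lt0r_neq0// mul1r.
Qed.

(** * The contribution of one edge *)

Lemma chi_term_mean (R : realType) (a x y : R) : 0 < x -> 0 < y ->
  2 `^ (a - 1) * (x + y) `^ (- a) = (2 * ((x + y) / 2) `^ a)^-1.
Proof.
move=> x0 y0; have xy0 : 0 < x + y by rewrite addr_gt0.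
rewrite powRB ?pnatr_eq0 ?implybT// powRr1// powRM ?invr_ge0 ?ltW//.
rewrite -[2^-1 in RHS]powR_inv1// -powRrM mulN1r !powRN.
by field; rewrite !lt0r_neq0 ?powR_gt0.
Qed.

Lemma isd_term_le (R : realType) (a x y : R) :
  (a < 0) || (1 < a) -> 0 < x -> 0 < y ->
  1 / (x `^ a + y `^ a) <= 2 `^ (a - 1) * (x + y) `^ (- a) ?= iff (x == y).
Proof.
move=> ha x0 y0; have h := powR_mean_le ha x0 y0.
have p0 : 0 < x `^ a + y `^ a by rewrite addr_gt0// powR_gt0.
have q0 : 0 < 2 * ((x + y) / 2) `^ a.
  by rewrite mulr_gt0// powR_gt0// divr_gt0// addr_gt0.
rewrite chi_term_mean// mul1r; split; first by rewrite lef_pV2 ?h.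
by rewrite (inj_eq invr_inj) eq_sym h.
Qed.

Lemma isd_term_ge (R : realType) (a x y : R) :
  0 < a < 1 -> 0 < x -> 0 < y ->
  2 `^ (a - 1) * (x + y) `^ (- a) <= 1 / (x `^ a + y `^ a) ?= iff (x == y).
Proof.
move=> ha x0 y0; have h := powR_mean_ge ha x0 y0.
have p0 : 0 < x `^ a + y `^ a by rewrite addr_gt0// powR_gt0.
have q0 : 0 < 2 * ((x + y) / 2) `^ a.
  by rewrite mulr_gt0// powR_gt0// divr_gt0// addr_gt0.
rewrite chi_term_mean// mul1r; split; first by rewrite lef_pV2 ?h.
by rewrite (inj_eq invr_inj) eq_sym h.
Qed.

(** * Regular components and sums over edges *)

Definition deg_const_on_edges (G : sgraph) : bool :=
  [forall u : G, forall v : G, adj u v ==> (deg u == deg v)].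

Lemma deg_const_on_edgesP (G : sgraph) :
  reflect (forall u v : G, adj u v -> deg u = deg v) (deg_const_on_edges G).
Proof.
apply: (iffP forallP) => h u; last first.
  by apply/forallP => v; apply/implyP => /h ->.
by move=> v uv; apply/eqP; move/forallP/(_ v)/implyP: (h u); apply.
Qed.

(** A component is closed under adjacency, so passing to the induced subgraph
    loses no neighbour. *)
Lemma deg_induced (G : sgraph) (C : {set G}) (x : induced C) :
  C \in components G -> deg x = deg (val x).
Proof.
case/imsetP => r _ CE.
have inC w : (w \in C) = connect (@adj G) r w by rewrite CE !inE.
have nbr v : adj (val x) v -> v \in C.
  move=> xv; have := valP x; rewrite !inC => rx.
  exact: connect_trans rx (connect1 xv).
rewrite /deg -(card_imset _ val_inj); apply: eq_card => v.
apply/imsetP/idP => [[w] | ]; first by rewrite !inE => xw ->.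
by rewrite inE => xv; exists (Sub v (nbr v xv)); rewrite ?inE.
Qed.

(** The degree is constant along edges iff it is constant along paths, hence on
    each connectivity class. *)
Lemma regular_componentsP (G : sgraph) :
  (forall C : {set G}, C \in components G -> regular (induced C)) <->
  deg_const_on_edges G.
Proof.
split=> [reg | /deg_const_on_edgesP const C CG x y].
  apply/deg_const_on_edgesP => u v uv.
  pose C := [set w in [set: G] | connect (@adj G) u w].
  have CG : C \in components G by apply/imsetP; exists u; rewrite ?inE.
  have uC : u \in C by rewrite !inE connect0.
  have vC : v \in C by rewrite !inE connect1.
  have := reg C CG (Sub u uC) (Sub v vC).
  by rewrite !deg_induced.
rewrite !deg_induced//; case/imsetP: CG (valP x) (valP y) => r _ CE.
have inC w : (w \in C) = connect (@adj G) r w by rewrite CE !inE.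
rewrite !inC; have closedr : closed (@adj G) [pred w | deg w == deg r].
  by move=> u v /const; rewrite !inE => ->.
move=> /(closed_connect closedr) + /(closed_connect closedr).
by rewrite !inE eqxx => /esym/eqP -> /esym/eqP ->.
Qed.

Lemma edgesP (G : sgraph) (f : {set G}) :
  reflect (exists u v, adj u v /\ f = [set u; v]) (f \in edges G).
Proof.
apply: (iffP imset2P) => [[u v _] | [u [v [uv ->]]]].
  by rewrite inE => /andP[_ uv] ->; exists u, v.
by exists u v; rewrite ?inE.
Qed.

(** This turns an inequality between functions of the two endpoint degrees of
    an edge, with its equality case, into one between the corresponding graph
    indices. *)
Lemma leif_sum_edges (R : realType) (G : sgraph) (E1 E2 : {set G} -> R) :
  (forall u v : G, adj u v ->
     E1 [set u; v] <= E2 [set u; v] ?= iff (deg u == deg v)) ->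
  \sum_(f in edges G) E1 f <= \sum_(f in edges G) E2 f
    ?= iff deg_const_on_edges G.
Proof.
move=> h.
(* A condition on the edge as a set of vertices, with no ordered endpoints:
   all degrees in it agree. *)
pose C (f : {set G}) := [forall u in f, forall v in f, deg u == deg v].
have CE u v : C [set u; v] = (deg u == deg v).
  apply/idP/idP => [/forall_inP/(_ u (set21 _ _)) | /eqP uv].
    by move=> /forall_inP/(_ v (set22 _ _)).
  apply/forall_inP => w /set2P hw; apply/forall_inP => z /set2P hz.
  by case: hw => ->; case: hz => ->; rewrite ?uv.
have -> : deg_const_on_edges G = [forall (f | f \in edges G), C f].
  apply/deg_const_on_edgesP/forall_inP => [hd _ /edgesP[u [v [uv ->]]] | hC u v uv].
    by rewrite CE; apply/eqP; exact: hd.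
  by apply/eqP; rewrite -CE hC//; apply/edgesP; exists u, v.
by apply: leif_sum => _ /edgesP[u [v [uv ->]]]; rewrite CE; exact: h.
Qed.

Lemma ltr_sum_edges (R : realType) (G : sgraph) (E1 E2 : {set G} -> R) :
  (0 < #|G|)%N -> no_isolated G ->
  (forall u v : G, adj u v -> E1 [set u; v] < E2 [set u; v]) ->
  \sum_(f in edges G) E1 f < \sum_(f in edges G) E2 f.
Proof.
move=> /card_gt0P[u _] /(_ u)[v uv] h; apply: ltr_sum => [|f /edgesP].
  apply/hasP; exists [set u; v]; first exact: mem_index_enum.
  by apply/edgesP; exists u, v.
by case=> x [y [xy ->]]; exact: h.
Qed.

Lemma deg_gt0 (R : realType) (G : sgraph) (u : G) :
  no_isolated G -> 0 < (deg u)%:R :> R.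
Proof.
by move=> /(_ u)[v uv]; rewrite ltr0n; apply/card_gt0P; exists v; rewrite inE.
Qed.

Theorem theorem3 (R : realType) (G : sgraph) (a : R)
    (hG : (0 < #|G|)%N) (hiso : no_isolated G)
    (ha0 : a != 0) (ha1 : a != 1) :
  [/\ (1 < a ->
        [/\ chi (- a) G < ISD a G,
            ISD a G <= 2 `^ (a - 1) * chi (- a) G
          & ISD a G = 2 `^ (a - 1) * chi (- a) G <->
            (forall C : {set G}, C \in components G -> regular (induced C))]),
      (0 < a < 1 ->
        [/\ 2 `^ (a - 1) * chi (- a) G <= ISD a G,
            ISD a G < chi (- a) G
          & 2 `^ (a - 1) * chi (- a) G = ISD a G <->
            (forall C : {set G}, C \in components G -> regular (induced C))])
    & (a < 0 ->
        ISD a G <= 2 `^ (a - 1) * chi (- a) G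
        /\ (ISD a G = 2 `^ (a - 1) * chi (- a) G <->
            (forall C : {set G}, C \in components G -> regular (induced C))))].

Proof.
have d0 (u : G) := deg_gt0 R u hiso.
have upper : (a < 0) || (1 < a) ->
    ISD a G <= 2 `^ (a - 1) * chi (- a) G ?= iff deg_const_on_edges G.
  move=> ha; rewrite /chi mulr_sumr; apply: leif_sum_edges => u v uv.
  by rewrite !sum_edge// -(eqr_nat R); exact: isd_term_le.
have lower : 0 < a < 1 ->
    2 `^ (a - 1) * chi (- a) G <= ISD a G ?= iff deg_const_on_edges G.
  move=> ha; rewrite /chi mulr_sumr; apply: leif_sum_edges => u v uv.
  by rewrite !sum_edge// -(eqr_nat R); exact: isd_term_ge.
have eqP_iff (x y : R) : x <= y ?= iff deg_const_on_edges G ->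
    (x = y <-> (forall C : {set G}, C \in components G -> regular (induced C))).
  move=> /eq_leif xy; rewrite regular_componentsP -xy.
  by split=> [-> | /eqP].
split=> ha.
- have le := upper (introT orP (or_intror ha)).
  split; [| exact: le | exact: eqP_iff].
  apply: ltr_sum_edges => // u v uv; rewrite !sum_edge// powRN mul1r.
  by rewrite ltf_pV2 ?posrE ?addr_gt0 ?powR_gt0 ?addr_gt0//; exact: powR_superadditive.
- have le := lower ha.
  split; [exact: le | | exact: eqP_iff].
  apply: ltr_sum_edges => // u v uv; rewrite !sum_edge// powRN mul1r.
  by rewrite ltf_pV2 ?posrE ?addr_gt0 ?powR_gt0 ?addr_gt0//; exact: powR_subadditive.
- have le := upper (introT orP (or_introl ha)).
  by split; [exact: le | exact: eqP_iff].
Qed.
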